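(* Let $m,n\ge 2$ and let $\mathrm{Br}_m$ and $\mathrm{Br}_n$ be the braid groups on $m$ and $n$ strands, respectively. Then $\mathrm{Br}_m$ and $\mathrm{Br}_n$ have the same elementary theory if and only if they are isomorphic. The result continues to hold if one only considers the $(\forall\exists\forall)^1$ fragment of the elementary theory: $\mathrm{Br}_m$ and $\mathrm{Br}_n$ satisfy the same $(\forall\exists\forall)^1$ sentences if and only if they are isomorphic.
   Context: The elementary theory of a group $G$ is the set of all first-order sentences in the language of groups $(\cdot,{}^{-1},1)$ that hold in $G$. A sentence is of class $(\forall\exists\forall)^1$ if it has the form $\forall x\,\exists y\,\forall z\,\Psi(x,y,z)$ with $\Psi$ quantifier-free. The braid group on $n+1$ strands ($n\geq 1$) is the Artin group of type $A_n$, i.e. the group with generators $x_1,\ldots,x_n$ and relations $x_ix_{i+1}x_i=x_{i+1}x_ix_{i+1}$ for $1\le i\le n-1$ and $x_ix_j=x_jx_i$ for $|i-j|\ge 2$. *)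

(* Defs.v *)
From HB Require Import structures.
From mathcomp Require Import all_boot.
From mathcomp Require Import boolp classical_sets.

Set Implicit Arguments.
Unset Strict Implicit.
Unset Printing Implicit Defensive.

Local Open Scope group_scope.
Local Open Scope classical_set_scope.

(* Terms of the language of groups (product, inverse, 1) over variables in X. *)

Inductive gterm (X : Type) : Type :=
| gvar of X
| gone
| ginv of gterm X
| gmul of gterm X & gterm X.

Arguments gone {X}.

Fixpoint geval (X : Type) (G : groupType) (env : X -> G) (t : gterm X) : G :=
  match t with
  | gvar x => env x
  | gone => 1
  | ginv u => (geval env u)^-1
  | gmul u v => geval env u * geval env v
  end.

(* [formula n] is the type of first-order formulas whose free variables are
   among n variables, indexed by 'I_n.  Variables are de Bruijn indices: under
   a quantifier, index 0 is the bound variable and index i.+1 stands for the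
   variable which has index i outside. *)

Inductive formula (n : nat) : Type :=
| fEq of gterm 'I_n & gterm 'I_n
| fNot of formula n
| fAnd of formula n & formula n
| fOr of formula n & formula n
| fImp of formula n & formula n
| fAll of formula n.+1
| fEx of formula n.+1.

Definition sentence : Type := formula 0.

Definition push (T : Type) (n : nat) (x : T) (env : 'I_n -> T) :
    'I_n.+1 -> T :=
  fun i => if unlift ord0 i is Some j then env j else x.

Fixpoint sat (G : groupType) (n : nat) (env : 'I_n -> G) (phi : formula n) :
    Prop :=
  match phi with
  | fEq t u => geval env t = geval env u
  | fNot p => ~ sat env p
  | fAnd p q => sat env p /\ sat env q
  | fOr p q => sat env p \/ sat env q
  | fImp p q => sat env p -> sat env q
  | fAll p => forall x : G, sat (push x env) p
  | fEx p => exists x : G, sat (push x env) p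
  end.

Definition no_var (T : Type) (i : 'I_0) : T :=
  match notF (ltn_ord i) with end.

Definition holds (G : groupType) (phi : sentence) : Prop :=
  sat (@no_var G) phi.

Definition elementary_theory (G : groupType) : set sentence :=
  [set phi | holds G phi].

Fixpoint quantifier_free (n : nat) (phi : formula n) : bool :=
  match phi with
  | fEq _ _ => true
  | fNot p => quantifier_free p
  | fAnd p q | fOr p q | fImp p q => quantifier_free p && quantifier_free q
  | fAll _ | fEx _ => false
  end.

(* The exponent 1 in the name of the class means one variable per quantifier
   block. *)
Definition AEA1 : set sentence :=
  [set phi | exists2 psi : formula 3,
      quantifier_free psi & phi = fAll (fEx (fAll psi))].

Definition AEA1_theory (G : groupType) : set sentence :=
  elementary_theory G `&` AEA1.

Definition isomorphic (G H : groupType) : Prop :=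
  exists2 f : G -> H, {morph f : x y / x * y} & bijective f.

(* The group <X | R> given by generators X and relations t = u, R t u, is the
   set of group terms over X modulo the least congruence which contains R and
   satisfies the group axioms. *)

Section Presentation.
Variables (X : Type) (R : gterm X -> gterm X -> Prop).

Inductive pres_eq : gterm X -> gterm X -> Prop :=
| pres_rel t u : R t u -> pres_eq t u
| pres_refl t : pres_eq t t
| pres_sym t u : pres_eq t u -> pres_eq u t
| pres_trans u t v : pres_eq t u -> pres_eq u v -> pres_eq t v
| pres_inv t u : pres_eq t u -> pres_eq (ginv t) (ginv u)
| pres_mul t t' u u' :
    pres_eq t t' -> pres_eq u u' -> pres_eq (gmul t u) (gmul t' u')
| pres_mulA t u v : pres_eq (gmul t (gmul u v)) (gmul (gmul t u) v)
| pres_mul1 t : pres_eq (gmul gone t) t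
| pres_mulr1 t : pres_eq (gmul t gone) t
| pres_mulV t : pres_eq (gmul (ginv t) t) gone
| pres_mulrV t : pres_eq (gmul t (ginv t)) gone.

Definition presented : Type :=
  {c : set (gterm X) | exists t, c = [set u | pres_eq t u]}.

HB.instance Definition _ := gen_eqMixin presented.
HB.instance Definition _ := gen_choiceMixin presented.

Definition pres_class (t : gterm X) : presented :=
  exist _ [set u | pres_eq t u] (ex_intro _ t erefl).

Lemma pres_classP t u : pres_class t = pres_class u <-> pres_eq t u.
Proof.
split=> [/(congr1 (@proj1_sig _ _)) /= e | tu].
  have: [set v | pres_eq u v] u by exact: pres_refl.
  by rewrite -e.
apply: eq_exist; apply/seteqP; split=> v /= h.
  exact: pres_trans (pres_sym tu) h.
exact: pres_trans tu h.
Qed.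

Lemma pres_class_surj (c : presented) : exists t, pres_class t = c.
Proof. by case: c => c [t e]; exists t; apply: eq_exist. Qed.

Definition pres_repr (c : presented) : gterm X := sval (cid (pres_class_surj c)).

Lemma pres_reprK c : pres_class (pres_repr c) = c.
Proof. exact: svalP (cid (pres_class_surj c)). Qed.

Lemma pres_class_repr t : pres_eq (pres_repr (pres_class t)) t.
Proof. by apply/pres_classP; rewrite pres_reprK. Qed.

Definition pone : presented := pres_class gone.
Definition pinv (c : presented) : presented :=
  pres_class (ginv (pres_repr c)).
Definition pmul (c d : presented) : presented :=
  pres_class (gmul (pres_repr c) (pres_repr d)).

Lemma pinvE t : pinv (pres_class t) = pres_class (ginv t).
Proof. by apply/pres_classP; apply: pres_inv; exact: pres_class_repr. Qed.

Lemma pmulE t u : pmul (pres_class t) (pres_class u) = pres_class (gmul t u).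
Proof. by apply/pres_classP; apply: pres_mul; exact: pres_class_repr. Qed.

Lemma pmulA : associative pmul.
Proof.
move=> a b c; rewrite -(pres_reprK a) -(pres_reprK b) -(pres_reprK c) !pmulE.
by apply/pres_classP; exact: pres_mulA.
Qed.

Lemma pmul1 : left_id pone pmul.
Proof.
by move=> a; rewrite -(pres_reprK a) pmulE; apply/pres_classP; exact: pres_mul1.
Qed.

Lemma pmulr1 : right_id pone pmul.
Proof.
by move=> a; rewrite -(pres_reprK a) pmulE; apply/pres_classP; exact: pres_mulr1.
Qed.

Lemma pmulV : left_inverse pone pinv pmul.
Proof.
move=> a; rewrite -(pres_reprK a) pinvE pmulE.
by apply/pres_classP; exact: pres_mulV.
Qed.

Lemma pmulrV : right_inverse pone pinv pmul.
Proof.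
move=> a; rewrite -(pres_reprK a) pinvE pmulE.
by apply/pres_classP; exact: pres_mulrV.
Qed.

HB.instance Definition _ := isGroup.Build presented pmulA pmul1 pmulr1 pmulV pmulrV.

Definition pres_gen (x : X) : presented := pres_class (gvar x).

Lemma pres_class1 : pres_class gone = 1.
Proof. by []. Qed.

Lemma pres_classV t : pres_class (ginv t) = (pres_class t)^-1.
Proof. by rewrite -[RHS]/(pinv _) pinvE. Qed.

Lemma pres_classM t u :
  pres_class (gmul t u) = pres_class t * pres_class u.
Proof. by rewrite -[RHS]/(pmul _ _) pmulE. Qed.

Lemma pres_classE t : pres_class t = geval pres_gen t.
Proof.
elim: t => [//|//|t IH|t IHt u IHu] /=; first by rewrite pres_classV IH.
by rewrite pres_classM IHt IHu.
Qed.

(* Universal property of <X | R>. *)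
Lemma presented_univ (G : groupType) (f : X -> G) :
    (forall t u, R t u -> geval f t = geval f u) ->
  exists! h : presented -> G,
    {morph h : x y / x * y} /\ forall x, h (pres_gen x) = f x.
Proof.
move=> fR.
have fE t u : pres_eq t u -> geval f t = geval f u.
  elim=> {t u} //=; first by move=> u t v _ -> _ ->.
  - by move=> t u _ ->.
  - by move=> t t' u u' _ -> _ ->.
  - by move=> t u v; rewrite mulgA.
  - by move=> t; rewrite mul1g.
  - by move=> t; rewrite mulg1.
  - by move=> t; rewrite mulVg.
  - by move=> t; rewrite mulgV.
pose h (c : presented) := geval f (pres_repr c).
have hE t : h (pres_class t) = geval f t by exact/fE/pres_class_repr.
exists h; split.
  split=> [a b|x]; last exact: hE.
  by rewrite -(pres_reprK a) -(pres_reprK b) -pres_classM !hE.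
move=> g [gM gf]; apply/funext=> c; rewrite -(pres_reprK c) hE.
have g1 : g 1 = 1 by apply: (@mulgI G (g 1)); rewrite -gM !mulg1.
elim: (pres_repr c) => {c} [x|//|t IH|t IHt u IHu] /=.
- by rewrite -gf.
- by apply: (@mulgI G (g (pres_class t))); rewrite pres_classV -gM mulgV g1 -IH mulgV.
- by rewrite pres_classM gM IHt IHu.
Qed.

End Presentation.

(* Relations between the n.-1 standard generators of the braid group on n
   strands, numbered from 0. *)

Inductive braid_rel (n : nat) : gterm 'I_n.-1 -> gterm 'I_n.-1 -> Prop :=
| braid_braid (i j : 'I_n.-1) : j = i.+1 :> nat ->
    braid_rel (gmul (gmul (gvar i) (gvar j)) (gvar i))
              (gmul (gmul (gvar j) (gvar i)) (gvar j))
| braid_comm (i j : 'I_n.-1) : (i.+2 <= j)%N || (j.+2 <= i)%N ->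
    braid_rel (gmul (gvar i) (gvar j)) (gmul (gvar j) (gvar i)).

Definition Br (n : nat) : groupType := presented (@braid_rel n).

(* Main.v *)
Require Import Defs.
From HB Require Import structures.
From Stdlib Require Import Setoid Morphisms.
From mathcomp Require Import all_boot ssralg ssrint zify.
From mathcomp Require Import boolp classical_sets.

(** Isomorphic groups satisfy the same sentences, so everything rests on one
    family of sentences of the right shape: let S_n say that every central
    element is an n-th power,
      for all x there is y such that: if x commutes with y then x = y^n,
    where a non-central x is dealt with by choosing for y an element which does
    not commute with it.  If 2 <= m < n, then S_n holds in Br_n and fails in
    Br_m, so that the two groups already differ on this fragment.

    S_n holds in Br_n (n >= 3, [center_power]) because the centre of Br_n is
    generated by the full twist, which is the n-th power of the rotation
    delta = s_(n-2) ... s_1 s_0.  This is Garside's theorem, and it is proved by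
    his method.  In the monoid of positive words modulo the braid relations,
    two letters which divide a word on the left have their least common multiple
    as a divisor ([beq_meet]); this gives cancellation, and it shows that a
    positive word w which permutes the letters (s_i w = w s_j) is a power of
    the half twist Delta ([quasi_central_garside]): as soon as one letter divides
    w all do, hence so does their lcm Delta, and one divides by Delta and goes
    on.  Delta reverses the order of the letters, so the central words are the
    even powers of Delta, and Delta^2 = delta^n by comparing lengths
    ([positive_center]).  As delta^n is central, is a multiple of every letter and
    is cancellable, each element of Br_n is a fraction w delta^(-nk), and
    positive words with the same value in Br_n are already congruent
    ([braid_inj]); so the centre of the monoid determines the centre of the group.

    S_n fails in Br_m (1 < m < n, [full_twist_not_power]) because the full twist
    of Br_m is not an n-th power.  Braids act on pairs of positions together
    with a counter of the full turns that the two strands make around each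
    other, and the full twist fixes all positions and adds 1 to each counter.  If
    b^n is the full twist, two strands can be chosen which both come back to
    their places after l <= m repetitions of b, having made d full turns; then
    b^(nl) makes both nd and l turns, so n divides l, although 0 < l < n. *)

Set Implicit Arguments.
Unset Strict Implicit.
Unset Printing Implicit Defensive.

Local Open Scope nat_scope.

(** * Morphisms and elements of presented groups *)

Section Morphism.
Variables (G H : groupType) (f : G -> H).
Hypothesis fM : {morph f : x y / (x * y)%g}.

Lemma morph_one : f 1%g = 1%g.
Proof. by apply: (@mulgI _ (f 1%g)); rewrite -fM !mulg1. Qed.

Lemma morph_inv x : f x^-1%g = (f x)^-1%g.
Proof. by apply: (@mulgI _ (f x)); rewrite -fM !mulgV morph_one. Qed.

Lemma morph_exp x k : f (x ^+ k)%g = (f x ^+ k)%g.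
Proof. by elim: k => [|k IH]; rewrite ?expg0 ?morph_one // !expgS fM IH. Qed.

End Morphism.

Local Open Scope group_scope.

Lemma pres_ind (X : Type) (R : gterm X -> gterm X -> Prop)
    (P : presented R -> Prop) :
    (forall x, P (pres_gen R x)) -> P 1 -> (forall c, P c -> P c^-1) ->
    (forall c d, P c -> P d -> P (c * d)) ->
  forall c, P c.
Proof.
move=> Pg P1 PV PM c; rewrite -(pres_reprK c) pres_classE.
by elim: (pres_repr c) => {c} //= t IH; [apply: PV|move=> u; apply: PM].
Qed.

Lemma central_gens (X : Type) (R : gterm X -> gterm X -> Prop)
    (z : presented R) :
  (forall x, commute z (pres_gen R x)) -> forall c, commute z c.
Proof.
move=> zX; apply: pres_ind => //; first exact: commute1.
- by move=> c; apply: commuteV.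
- by move=> c d; apply: commuteM.
Qed.

Local Open Scope nat_scope.

(** * Positive braid words and Garside's divisibility lemma *)

Definition far (i j : nat) : bool := (i.+1 < j) || (j.+1 < i).
Definition adj (i j : nat) : bool := (j == i.+1) || (i == j.+1).

Lemma farC i j : far i j = far j i. Proof. by rewrite /far orbC. Qed.
Lemma adjC i j : adj i j = adj j i. Proof. by rewrite /adj orbC. Qed.

Lemma index_cases i j : [\/ i = j, far i j | adj i j].
Proof.
case: (ltngtP i j) => [ij|ji|->]; last by constructor 1.
- case: (ltngtP i.+1 j) => h; [constructor 2|lia|constructor 3];
    rewrite /far /adj; lia.
- case: (ltngtP j.+1 i) => h; [constructor 2|lia|constructor 3];
    rewrite /far /adj; lia.
Qed.

Inductive bstep : seq nat -> seq nat -> Prop :=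
| bstep_far i j u : far i j -> bstep [:: i, j & u] [:: j, i & u]
| bstep_adj i j u : adj i j -> bstep [:: i, j, i & u] [:: j, i, j & u]
| bstep_cons i u v : bstep u v -> bstep (i :: u) (i :: v).

Inductive beq (u : seq nat) : seq nat -> Prop :=
| beq_refl : beq u u
| beq_step v w : bstep u v -> beq v w -> beq u w.

Notation "u ≡ v" := (beq u v) (at level 70, no associativity).

#[local] Hint Resolve beq_refl : core.

Lemma bstep_sym u v : bstep u v -> bstep v u.
Proof.
elim=> {u v} [i j u h|i j u h|i u v _ h].
- by apply: bstep_far; rewrite farC.
- by apply: bstep_adj; rewrite adjC.
- exact: bstep_cons.
Qed.

Lemma beq_trans u v w : u ≡ v -> v ≡ w -> u ≡ w.
Proof. by elim=> {u v} [//|u v x uv _ IH /IH]; apply: beq_step. Qed.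

Lemma beq_step1 u v : bstep u v -> u ≡ v.
Proof. by move=> uv; apply: beq_step uv _. Qed.

Lemma beq_sym u v : u ≡ v -> v ≡ u.
Proof.
elim=> {u v} [u|u v w /bstep_sym/beq_step1 vu _ wv]; first exact: beq_refl.
exact: beq_trans wv vu.
Qed.

#[local] Instance beq_equiv : Equivalence beq.
Proof. by split; [exact: beq_refl|exact: beq_sym|exact: beq_trans]. Qed.

Lemma beq_cons i u v : u ≡ v -> i :: u ≡ i :: v.
Proof.
elim=> {u v} [u|u v w uv _]; first exact: beq_refl.
by apply: beq_step; apply: bstep_cons.
Qed.

#[local] Instance cons_beq : Proper (eq ==> beq ==> beq) (@cons nat).
Proof. by move=> i _ <- u v; apply: beq_cons. Qed.

Lemma bstep_catr u v w : bstep u v -> bstep (u ++ w) (v ++ w).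
Proof. by elim=> {u v} /= *; constructor. Qed.

#[local] Instance cat_beq : Proper (beq ==> beq ==> beq) (@cat nat).
Proof.
move=> u u' uu' v v' vv'; transitivity (u ++ v').
  by elim: u {uu'} => //= i u IH; rewrite IH.
elim: uu' => {u u'} [u|u x y ux _ IH]; first exact: beq_refl.
exact: beq_step (bstep_catr _ ux) IH.
Qed.

Lemma far_swap i j u : far i j -> [:: i, j & u] ≡ [:: j, i & u].
Proof. by move=> h; apply/beq_step1/bstep_far. Qed.

Lemma adj_braid i j u : adj i j -> [:: i, j, i & u] ≡ [:: j, i, j & u].
Proof. by move=> h; apply/beq_step1/bstep_adj. Qed.

Lemma beq_size u v : u ≡ v -> size u = size v.
Proof.
elim=> {u v} [//|u v w uv _ <-].
by elim: uv => {u v w} //= i u v _ ->.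
Qed.

Lemma beq_all (p : pred nat) u v : u ≡ v -> all p u = all p v.
Proof.
elim=> {u v} [//|u v w uv _ <-].
elim: uv => {u v w} /= [i j u _|i j u _|i u v _ -> //].
  by rewrite andbCA.
by case: (p i); case: (p j).
Qed.

Lemma beq_rev u v : u ≡ v -> rev u ≡ rev v.
Proof.
elim=> {u v} [u|u v w uv _ IH]; first exact: beq_refl.
apply: beq_trans IH => {w}.
elim: uv => {u v} [i j u h|i j u h|i u v _ IH].
- rewrite !rev_cons -!cats1 -!catA /=; apply: cat_beq => //.
  by apply: far_swap; rewrite farC.
- rewrite !rev_cons -!cats1 -!catA /=; apply: cat_beq => //.
  by apply: adj_braid.
- by rewrite !rev_cons -!cats1 IH.
Qed.

(** The letters [i] and [j] have a least common right multiple, namely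
    [i :: cofactor i j], which is congruent to [j :: cofactor j i]. *)
Definition cofactor (i j : nat) : seq nat :=
  if i == j then [::] else if far i j then [:: j] else [:: j; i].

Lemma cofactor_far i j : far i j -> cofactor i j = [:: j].
Proof.
move=> h; rewrite /cofactor h ifN //.
by apply: contraTneq h => ->; rewrite /far; lia.
Qed.

Lemma cofactor_adj i j : adj i j -> cofactor i j = [:: j; i].
Proof. by move=> h; rewrite /cofactor !ifN //; move: h; rewrite /far /adj; lia. Qed.

(** A common multiple [i :: u ≡ j :: v] of two letters is a multiple of their
    least common multiple. *)
Definition meet_at_lcm i u j v :=
  exists w, u ≡ cofactor i j ++ w /\ v ≡ cofactor j i ++ w.

Lemma meet_at_lcm_refl i u v : u ≡ v -> meet_at_lcm i u i v.
Proof. by move=> uv; exists v; rewrite /cofactor eqxx. Qed.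

Lemma meet_at_lcm_sym i u j v : meet_at_lcm i u j v -> meet_at_lcm j v i u.
Proof. by case=> w [h h']; exists w. Qed.

Lemma meet_far i u j v : far i j -> meet_at_lcm i u j v ->
  exists w, u ≡ j :: w /\ v ≡ i :: w.
Proof. by move=> h [w]; rewrite !cofactor_far // 1?farC // => e; exists w. Qed.

Lemma meet_adj i u j v : adj i j -> meet_at_lcm i u j v ->
  exists w, u ≡ [:: j, i & w] /\ v ≡ [:: i, j & w].
Proof. by move=> h [w]; rewrite !cofactor_adj // 1?adjC // => e; exists w. Qed.

(** The conclusion of Garside's lemma holds for two words one step apart; it passes
    to chains of steps if it is transitive.  Here transitivity through a word
    [h :: t] is derived from the lemma for shorter words, applied to the two
    factorizations of [t] through [cofactor h i] and [cofactor h j].  There is one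
    case for each graph on the letters [i], [h], [j]. *)
Section Transitivity.
Variable n : nat.
Hypothesis IH : forall i u j v,
  size u < n -> i :: u ≡ j :: v -> meet_at_lcm i u j v.

Let cancel i u v : size u < n -> i :: u ≡ i :: v -> u ≡ v.
Proof.
by move=> un /(IH un)[w]; rewrite /cofactor eqxx => -[-> ->].
Qed.

Let IHfar i u j v : far i j -> size u < n -> i :: u ≡ j :: v ->
  exists w, u ≡ j :: w /\ v ≡ i :: w.
Proof. by move=> h un /(IH un)/(meet_far h). Qed.

Let IHadj i u j v : adj i j -> size u < n -> i :: u ≡ j :: v ->
  exists w, u ≡ [:: j, i & w] /\ v ≡ [:: i, j & w].
Proof. by move=> h un /(IH un)/(meet_adj h). Qed.

Let trans_adj_far_far i u h t j v : size u <= n ->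
    adj i h -> far h j -> far i j ->
  meet_at_lcm i u h t -> meet_at_lcm h t j v -> meet_at_lcm i u j v.
Proof.
move=> un ih hj ij /(meet_adj ih)[w1 [e1 e2]] /(meet_far hj)[w2 [e3 e4]].
have su := beq_size e1; have st := beq_size e2; rewrite /= in su st.
have [||a [ea1 ea2]] := IHfar (u := h :: w1) (v := w2) ij.
- by rewrite /=; lia.
- by rewrite -e2.
have [||b [eb1 eb2]] := IHfar (u := w1) (v := a) hj; [lia|done|].
exists [:: h, i & b]; rewrite !cofactor_far // 1?farC //=; split.
  by rewrite e1 eb1 (far_swap b ij) (far_swap _ hj).
by rewrite e4 ea2 eb2 -(adj_braid _ ih).
Qed.

(** The letters generate a braid group on four strands, with [i] in the middle; the
    lcm of the three letters is its half twist, of length 6. *)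
Let trans_adj_far_adj i u h t j v : size u <= n ->
    adj i h -> far h j -> adj i j ->
  meet_at_lcm i u h t -> meet_at_lcm h t j v -> meet_at_lcm i u j v.
Proof.
move=> un ih hj ij /(meet_adj ih)[w1 [e1 e2]] /(meet_far hj)[w2 [e3 e4]].
have su := beq_size e1; have st := beq_size e2; rewrite /= in su st.
have [||a [ea1 ea2]] := IHadj (u := h :: w1) (v := w2) ij.
- by rewrite /=; lia.
- by rewrite -e2.
have [||b [eb1 eb2]] := IHfar (u := w1) (v := i :: a) hj; [lia|done|].
have sa := beq_size ea1; rewrite /= in sa.
have [||c [ec1 ec2]] := IHadj (u := a) (v := b) ih; [lia|done|].
have hj' : far j h by rewrite farC.
have ji : adj j i by rewrite adjC.
exists [:: h, i, j & c]; rewrite !cofactor_adj //=; split.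
  rewrite e1 eb1 ec2 (adj_braid _ ij) (far_swap _ hj) (far_swap c hj').
  by rewrite -(adj_braid _ ih).
rewrite e4 ea2 ec1 (far_swap _ hj') -(adj_braid _ ih) (adj_braid _ ij).
by rewrite (far_swap _ hj).
Qed.

Let trans_far_far_far i u h t j v : size u <= n ->
    far i h -> far h j -> far i j ->
  meet_at_lcm i u h t -> meet_at_lcm h t j v -> meet_at_lcm i u j v.
Proof.
move=> un ih hj ij /(meet_far ih)[w1 [e1 e2]] /(meet_far hj)[w2 [e3 e4]].
have su := beq_size e1; have st := beq_size e2; rewrite /= in su st.
have [||a [ea1 ea2]] := IHfar (u := w1) (v := w2) ij; [lia|by rewrite -e2|].
exists (h :: a); rewrite !cofactor_far // 1?farC //=; split.
  by rewrite e1 ea1 (far_swap _ hj).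
by rewrite e4 ea2 (far_swap _ ih).
Qed.

Let trans_far_far_adj i u h t j v : size u <= n ->
    far i h -> far h j -> adj i j ->
  meet_at_lcm i u h t -> meet_at_lcm h t j v -> meet_at_lcm i u j v.
Proof.
move=> un ih hj ij /(meet_far ih)[w1 [e1 e2]] /(meet_far hj)[w2 [e3 e4]].
have su := beq_size e1; have st := beq_size e2; rewrite /= in su st.
have [||a [ea1 ea2]] := IHadj (u := w1) (v := w2) ij; [lia|by rewrite -e2|].
have hi : far h i by rewrite farC.
exists (h :: a); rewrite !cofactor_adj // 1?adjC //=; split.
  by rewrite e1 ea1 (far_swap _ hj) (far_swap _ hi).
by rewrite e4 ea2 (far_swap _ hi) (far_swap _ hj).
Qed.

(** Braids on four strands again, now with [h] in the middle. *)
Let trans_adj_adj_far i u h t j v : size u <= n ->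
    adj i h -> adj h j -> far i j ->
  meet_at_lcm i u h t -> meet_at_lcm h t j v -> meet_at_lcm i u j v.
Proof.
move=> un ih hj ij /(meet_adj ih)[w1 [e1 e2]] /(meet_adj hj)[w2 [e3 e4]].
have su := beq_size e1; have st := beq_size e2; rewrite /= in su st.
have st' := beq_size e3; rewrite /= in st'.
have hi : adj h i by rewrite adjC.
have ji : far j i by rewrite farC.
have [||a [ea1 ea2]] := IHfar (u := h :: w1) (v := h :: w2) ij.
- by rewrite /=; lia.
- by rewrite -e2.
have [||b [eb1 eb2]] := IHadj (u := w1) (v := a) hj; [lia|done|].
have [||c [ec1 ec2]] := IHadj (u := w2) (v := a) hi; [lia|done|].
have sa := beq_size eb2; have sw1 := beq_size eb1; rewrite /= in sa sw1.
have e : [:: h, j & b] ≡ [:: h, i & c] by rewrite -eb2.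
have {}e : j :: b ≡ i :: c by apply: cancel e => /=; lia.
have [|d [ed1 ed2]] := IHfar ji _ e; first lia.
exists [:: h, j, i, h & d]; rewrite !cofactor_far //=; split.
  by rewrite e1 eb1 ed1 (far_swap _ ij) (adj_braid _ ih) (adj_braid _ hj).
rewrite e4 ec1 ed2 (far_swap _ ji) -(adj_braid _ hj) (adj_braid _ hi).
by rewrite (far_swap _ ij).
Qed.

(** The remaining cases: two letters may coincide, the roles of [i] and [j] may be
    exchanged, and three pairwise adjacent letters do not exist. *)
Lemma meet_at_lcm_trans i u h t j v : size u <= n ->
  meet_at_lcm i u h t -> meet_at_lcm h t j v -> meet_at_lcm i u j v.
Proof.
move=> un.
case: (index_cases i h) => [<-|ih|ih].
- case=> w []; rewrite /cofactor eqxx /= => uw tw [x [e1 e2]].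
  by exists x; split=> //; rewrite uw -tw.
- case: (index_cases h j) => [<-|hj|hj].
  + move=> [x [e1 e2]] [w []]; rewrite /cofactor eqxx /= => tw vw.
    by exists x; split=> //; rewrite vw -tw.
  + case: (index_cases i j) => [ij|ij|ij].
    * subst j; move=> /(meet_far ih)[w [e1 e2]] /(meet_far hj)[x [e3 e4]].
      have su := beq_size e1; have st := beq_size e2; rewrite /= in su st.
      apply: meet_at_lcm_refl; rewrite e1 e4; apply: beq_cons.
      by apply: (@cancel i); [lia|rewrite -e2].
    * exact: trans_far_far_far.
    * exact: trans_far_far_adj.
  + move=> m1 m2; apply: meet_at_lcm_sym.
    have sv : size v <= n.
      case: (meet_far ih m1) (meet_adj hj m2) => w [e1 e2] [x [e3 e4]].
      move: (beq_size e1) (beq_size e2) (beq_size e3) (beq_size e4) => /=; lia.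
    move: m1 m2 => /meet_at_lcm_sym m1 /meet_at_lcm_sym m2.
    rewrite farC in ih; rewrite adjC in hj.
    case: (index_cases i j) => [ij|ij|ij].
    * by subst j; move: ih hj; rewrite /far /adj; lia.
    * by apply: trans_adj_far_far m2 m1 => //; rewrite farC.
    * by apply: trans_adj_far_adj m2 m1 => //; rewrite adjC.
- case: (index_cases h j) => [<-|hj|hj].
  + move=> [x [e1 e2]] [w []]; rewrite /cofactor eqxx /= => tw vw.
    by exists x; split=> //; rewrite vw -tw.
  + case: (index_cases i j) => [ij|ij|ij].
    * by subst j; move: ih hj; rewrite /far /adj; lia.
    * exact: trans_adj_far_far.
    * exact: trans_adj_far_adj.
  + case: (index_cases i j) => [ij|ij|ij].
    * subst j; move=> /(meet_adj ih)[w [e1 e2]] /(meet_adj hj)[x [e3 e4]].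
      have su := beq_size e1; have st := beq_size e2; rewrite /= in su st.
      apply: meet_at_lcm_refl; rewrite e1 e4; do 2 apply: beq_cons.
      apply: (@cancel h); first lia.
      by apply: (@cancel i); [rewrite /=; lia|rewrite -e2].
    * exact: trans_adj_adj_far.
    * by exfalso; move: ih hj ij; rewrite /adj; lia.
Qed.

End Transitivity.

Lemma bstep_meet i u j v : bstep (i :: u) (j :: v) -> meet_at_lcm i u j v.
Proof.
move E1: (i :: u) => x; move E2: (j :: v) => y s.
case: s E1 E2 =>
  [a b w h [-> ->] [-> ->]|a b w h [-> ->] [-> ->]|a w z h [-> ->] [-> ->]].
- by exists w; rewrite !cofactor_far // 1?farC //; split.
- by exists w; rewrite !cofactor_adj // 1?adjC //; split.
- by apply: meet_at_lcm_refl; apply: beq_step1.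
Qed.

(** Garside's lemma, by induction on the length of the words and, for a given
    length, on the number of steps of the congruence. *)
Theorem beq_meet i u j v : i :: u ≡ j :: v -> meet_at_lcm i u j v.
Proof.
have [n] := ubnP (size u); elim: n => // n IHn in i u j v *; rewrite ltnS => un.
move E1: (i :: u) => x; move E2: (j :: v) => y h.
elim: h i u un E1 E2 => {x y} [x|x z y s _ IHs] i u un E1 E2.
  by move: E2; rewrite -E1 => -[-> ->]; apply: meet_at_lcm_refl.
have sz := beq_size (beq_step1 s).
case: z s sz IHs => [|h t] s sz IHs; first by rewrite -E1 in sz.
rewrite -E1 in s sz; apply: (@meet_at_lcm_trans n) (bstep_meet s) _ => //.
apply: IHs => //; case: sz => <- //.
Qed.

Lemma beq_consI i u v : i :: u ≡ i :: v -> u ≡ v.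
Proof. by move/beq_meet=> [w]; rewrite /cofactor eqxx => -[-> ->]. Qed.

Lemma beq_catI w u v : w ++ u ≡ w ++ v -> u ≡ v.
Proof. by elim: w => //= i w IH /beq_consI. Qed.

Lemma beq_cat2I w u v : u ++ w ≡ v ++ w -> u ≡ v.
Proof.
move/beq_rev; rewrite !rev_cat => /beq_catI/beq_rev; by rewrite !revK.
Qed.

(** * The centre of the positive braid monoid *)

Definition below (n : nat) : pred (seq nat) := all (fun i => i < n).

Lemma far_pass j u : all (far j) u -> j :: u ≡ u ++ [:: j].
Proof.
elim: u => //= i u IH /andP[ji ju].
by rewrite (far_swap _ ji) (IH ju).
Qed.

(** Letters far from [j] contribute nothing to the divisibility by [j]. *)
Lemma far_divide j u x y : all (far j) u -> j :: x ≡ u ++ y ->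
  exists z, y ≡ j :: z.
Proof.
elim: u x => [|i u IH] x /=; first by exists x; apply: beq_sym.
case/andP=> ji ju /beq_meet/(meet_far ji)[w [_ e]].
by apply: (IH w) => //; apply: beq_sym.
Qed.

Lemma below_far j n u : n < j -> below n u -> all (far j) u.
Proof. by move=> nj; apply: sub_all => i; rewrite /far; lia. Qed.

Lemma below_cat n u v : below n (u ++ v) = below n u && below n v.
Proof. exact: all_cat. Qed.

Lemma belowW m n u : m <= n -> below m u -> below n u.
Proof. by move=> mn; apply: sub_all => i h; apply: leq_trans h mn. Qed.

(** The word [j + l - 1, ..., j + 1, j]. *)
Fixpoint descent (j l : nat) : seq nat :=
  if l is l'.+1 then j + l' :: descent j l' else [::].

Lemma descentS j l : descent j l.+1 = j + l :: descent j l.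
Proof. by []. Qed.

(** In terms of [n.+1] strands, [delta n] is the rotation by one place: the last
    strand passes across all others to become the first. *)
Definition delta (n : nat) : seq nat := descent 0 n.

Lemma deltaS n : delta n.+1 = n :: delta n.
Proof. by []. Qed.

Lemma delta_below n : below n (delta n).
Proof.
elim: n => //= n IH; rewrite add0n ltnSn /=.
by apply: belowW IH.
Qed.

Lemma size_delta n : size (delta n) = n.
Proof. by elim: n => //= n ->. Qed.

Lemma map_succ_delta n : map succn (delta n) ++ [:: 0] = delta n.+1.
Proof. by elim: n => //= n ->; rewrite !add0n. Qed.

Lemma delta_shift i n : i.+1 < n -> i :: delta n ≡ delta n ++ [:: i.+1].
Proof.
elim: n => // n IH; rewrite ltnS leq_eqVlt deltaS => /orP[/eqP<-|ilt] /=.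
  rewrite deltaS adj_braid; last by rewrite /adj eqxx.
  by rewrite (@far_pass i.+1 (delta i)) //; apply: below_far (delta_below i).
by rewrite far_swap ?IH // /far ilt.
Qed.

Lemma delta_shifts n u : all (fun i => i.+1 < n) u ->
  u ++ delta n ≡ delta n ++ map succn u.
Proof.
elim: u => [|i u IH] /=; first by rewrite cats0.
by case/andP=> il /IH ->; rewrite -cat_cons (delta_shift il) -catA.
Qed.

(** Move the first factor to the right through the second: its letters go up by one,
    and the letter 0 is what they lack to form a new rotation. *)
Lemma delta_delta n : delta n ++ delta n.+1 ++ [:: 0] ≡ delta n.+1 ++ delta n.+1.
Proof.
rewrite catA delta_shifts; first by rewrite -catA map_succ_delta.
by apply: sub_all (delta_below n).
Qed.

(** The rotation moves each letter to the next; the last letter has no next one, but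
    two rotations bring it back to the first, as if there were [n.+2] letters
    around the circle. *)
Lemma delta_wrap n :
  n :: delta n.+1 ++ delta n.+1 ≡ delta n.+1 ++ delta n.+1 ++ [:: 0].
Proof. by rewrite -delta_delta. Qed.

Definition wexp (u : seq nat) (k : nat) : seq nat := iter k (cat u) [::].

Lemma wexpS u k : wexp u k.+1 = u ++ wexp u k. Proof. by []. Qed.

Lemma wexpD u k l : wexp u (k + l) = wexp u k ++ wexp u l.
Proof. by elim: k => //= k ->; rewrite catA. Qed.

Lemma wexpM u k l : wexp (wexp u k) l = wexp u (l * k).
Proof. by elim: l => //= l ->; rewrite mulSn wexpD. Qed.

#[local] Instance wexp_beq : Proper (beq ==> eq ==> beq) wexp.
Proof. by move=> u v uv k _ <-; elim: k => //= k IH; apply: cat_beq. Qed.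

Lemma size_wexp u k : size (wexp u k) = k * size u.
Proof. by elim: k => //= k IH; rewrite size_cat IH mulSn. Qed.

Lemma wexp_below n u k : below n u -> below n (wexp u k).
Proof. by move=> h; elim: k => //= k IH; rewrite below_cat h. Qed.

Lemma delta_exp_shift n i k : i + k < n ->
  i :: wexp (delta n) k ≡ wexp (delta n) k ++ [:: i + k].
Proof.
elim: k i => [|k IH] i ikn; first by rewrite addn0.
rewrite wexpS -cat_cons delta_shift; last lia.
by rewrite -!catA /= IH ?addSnnS //; lia.
Qed.

(** A complete turn of the [n.+1] strands, one rotation at a time. *)
Definition twist (n : nat) : seq nat := wexp (delta n) n.+1.

Lemma twist_below n : below n (twist n).
Proof. exact/wexp_below/delta_below. Qed.

Lemma twist_comm n i : i < n -> i :: twist n ≡ twist n ++ [:: i].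
Proof.
case: n => // n; rewrite ltnS => lein.
have -> : twist n.+1 = wexp (delta n.+1) (n - i) ++ wexp (delta n.+1) 2 ++
                       wexp (delta n.+1) i.
  by rewrite -!wexpD; congr wexp; lia.
(* Rotations take the letter i up to the last letter n, then to 0, then to i. *)
rewrite -cat_cons delta_exp_shift; last lia.
rewrite subnKC // -!catA; apply: cat_beq => //.
rewrite !cat0s cat1s catA -cat_cons delta_wrap -!catA; do 2 apply: cat_beq => //.
by rewrite cat1s delta_exp_shift.
Qed.

Lemma twist_pass n u : below n u -> u ++ twist n ≡ twist n ++ u.
Proof.
elim: u => [|i u IH] /=; first by rewrite cats0.
by case/andP=> il /IH ->; rewrite -cat_cons (twist_comm il) -catA.
Qed.

Lemma twist_exp_pass n u k : below n u ->
  u ++ wexp (twist n) k ≡ wexp (twist n) k ++ u.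
Proof.
move=> un; elim: k => [|k IH] /=; first by rewrite cats0.
by rewrite catA twist_pass // -catA IH catA.
Qed.

(** Garside's half twist Delta.  The recursion adds one strand, which is led
    across all the others. *)
Fixpoint garside (n : nat) : seq nat :=
  if n is k.+1 then garside k ++ delta k.+1 else [::].

Lemma garside_below n : below n (garside n).
Proof.
elim: n => //= n IH; rewrite below_cat.
by apply/andP; split; [exact: belowW IH|exact: (delta_below n.+1)].
Qed.

Lemma size_garside n : (size (garside n)).*2 = n * n.+1.
Proof. by elim: n => //= n IH; rewrite size_cat /= size_delta; lia. Qed.

(** The half twist reverses the order of the strands, hence that of the letters. *)
Lemma garside_flip n i : i < n -> i :: garside n ≡ garside n ++ [:: n.-1 - i].
Proof.
elim: n i => // n IH i; rewrite ltnS leq_eqVlt => /orP[/eqP->|ilt].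
  rewrite [garside _]/= subnn; case: n IH => [//|n _].
  rewrite [garside _]/= -!catA -cat_cons (@far_pass n.+1); last first.
    exact: below_far (garside_below n).
  rewrite -catA; apply: cat_beq => //.
  by rewrite delta_delta.
rewrite [garside _]/= -cat_cons (IH _ ilt) -!catA /=.
rewrite -cat_cons (@delta_shift (n.-1 - i) n.+1); last lia.
by have -> : (n.-1 - i).+1 = n - i by lia.
Qed.

(** Garside's lemma pushed along a descending word, one letter at a time: this is
    the lcm of [j] and of the letters above it. *)
Lemma divide_descent j l x z : j :: x ≡ descent j.+1 l.+1 ++ z ->
  exists y, x ≡ descent j l.+2 ++ y.
Proof.
elim: l x z => [|l IH] x z.
  rewrite /= addn0 => /beq_meet/(@meet_adj j)[|w [e _]].
    by rewrite /adj eqxx.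
  by exists w; rewrite addn1 addn0.
rewrite descentS cat_cons => /beq_meet/(@meet_far j)[|w [e1 e2]].
  by rewrite /far; lia.
have /IH[y ey] : j :: w ≡ descent j.+1 l.+1 ++ z by rewrite e2.
by exists y; rewrite e1 ey (descentS j) cat_cons addSnnS.
Qed.

Lemma divide_delta j l y z : delta j ++ y ≡ descent j l.+1 ++ z ->
  exists x, y ≡ delta (j + l.+1) ++ x.
Proof.
elim: j l z => [|j IH] l z; first by exists z.
by case/divide_descent=> x /IH; rewrite addSnnS.
Qed.

(** By induction: if [garside n] divides [w], say [w = garside n ++ y], and the
    letter [n] divides [w] too, then [n] passes through [garside n.-1], whose
    letters are far from it, and [divide_delta] makes [delta n.+1] divide [y]. *)
Lemma garside_lcm n w : (forall i, i < n -> exists u, w ≡ i :: u) ->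
  exists u, w ≡ garside n ++ u.
Proof.
elim: n => [|n IH] divw; first by exists w.
have [|y wy] := IH; first by move=> i il; apply: divw; apply: ltnW.
have [u wu] := divw n (ltnSn n).
have [z yz] : exists z, delta n ++ y ≡ n :: z.
  case: n wy wu {IH divw} => [|n] wy wu; first by exists u; rewrite -wu wy.
  apply: (@far_divide n.+1 (garside n) u).
    exact: below_far (garside_below n).
  by rewrite -wu wy /= -catA.
have [|x yx] := @divide_delta n 0 y z.
  by rewrite yz /= addn0.
by exists x; rewrite wy yx /= addn1 -catA.
Qed.

(** The letter [j] may differ from [i], because a word which remains after division
    by the half twist is central only up to the reversal of the letters. *)
Definition quasi_central (n : nat) (w : seq nat) : Prop :=
  forall i, i < n -> exists j, i :: w ≡ w ++ [:: j].

(** Write [w] as [i :: u].  Since [i] and [j] both divide [j :: w], their lcm does,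
    so that [j] divides [u].  Now [i] can be moved through [w], which shows that [w] is
    [u] followed by a letter; hence [j] divides [w]. *)
Lemma quasi_central_divide n w i j : quasi_central n w ->
    i < n -> j < n -> adj i j ->
  (exists u, w ≡ i :: u) -> exists u, w ≡ j :: u.
Proof.
move=> qw il jl ij [u wu].
have [k wk] := qw j jl; have [l wl] := qw i il.
have /beq_meet/(meet_adj ij)[z [_ ez]] : i :: u ++ [:: k] ≡ j :: w.
  by rewrite wk wu.
have uw : w ≡ u ++ [:: l].
  by apply: (@beq_consI i); rewrite wl {1}wu.
have /beq_consI uz : i :: u ≡ [:: i, j & z] by rewrite -wu.
by exists (z ++ [:: l]); rewrite uw uz.
Qed.

(** The letters below [n] form a chain of adjacent letters. *)
Lemma quasi_central_divides n w i j : quasi_central n w ->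
    i < n -> j < n -> (exists u, w ≡ i :: u) -> exists u, w ≡ j :: u.
Proof.
move=> qw; have step k l := @quasi_central_divide n w k l qw.
move=> il jl di; have {di il i} : exists u, w ≡ 0 :: u.
  elim: i il di => // i IH il; move/(step i.+1 i il (ltnW il)).
  by rewrite /adj eqxx orbT => /(_ isT); apply: IH; apply: ltnW.
elim: j jl => // j IH jl d0; apply: (step j) => //; first exact: ltnW.
  by rewrite /adj eqxx.
by apply: IH => //; apply: ltnW.
Qed.

(** All letters divide a non-empty quasi-central word, hence so does the half
    twist, and the quotient is shorter and again quasi-central. *)
Theorem quasi_central_garside n w : below n w -> quasi_central n w ->
  exists k, w ≡ wexp (garside n) k.
Proof.
have [s] := ubnP (size w); elim: s w => // s IH [|i u] sw wn qw.
  by exists 0.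
have il : i < n by case/andP: wn.
have [|v wv] := @garside_lcm n (i :: u).
  by move=> j jl; apply: quasi_central_divides il jl _ => //; exists u.
have vn : below n v.
  by move: wn; rewrite /below (beq_all _ wv) -/(below n _) below_cat => /andP[].
have sv : size v < s.
  have := beq_size wv; have := size_garside n; rewrite size_cat.
  by move: sw; rewrite /= ltnS; nia.
have [j jl|k vk] := IH v sv vn; last by exists k.+1; rewrite wv vk.
have [|l el] := qw (n.-1 - j); first lia.
exists l; apply: (@beq_catI (garside n)).
rewrite catA -wv -el wv.
have -> : n.-1 - j :: garside n ++ v = (n.-1 - j :: garside n) ++ v by [].
by rewrite garside_flip -?catA ?subKn //; lia.
Qed.

(** The full twist is central, hence a power of the half twist, and the exponent is
    read off the lengths. *)
Lemma twist_garside n : 0 < n -> twist n ≡ wexp (garside n) 2.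
Proof.
move=> n0; have [|i il|k e] := @quasi_central_garside n (twist n).
- exact: twist_below.
- by exists i; apply: twist_comm.
suff <- : k = 2 by [].
have := beq_size e; have := size_garside n.
by rewrite !size_wexp size_delta; nia.
Qed.

Theorem positive_center n w : 1 < n -> below n w ->
    (forall i, i < n -> i :: w ≡ w ++ [:: i]) ->
  exists k, w ≡ wexp (twist n) k.
Proof.
move=> n1 wn cw.
have [k wk] := quasi_central_garside wn (fun i il => ex_intro _ i (cw i il)).
have g2 i l : i < n ->
    i :: wexp (garside n) l.*2 ≡ wexp (garside n) l.*2 ++ [:: i].
  move=> il; have -> : l.*2 = l * 2 by rewrite muln2.
  rewrite -wexpM -twist_garside; last lia.
  by rewrite -cat1s twist_exp_pass //= andbT.
suff ek : ~~ odd k.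
  exists k./2; rewrite twist_garside ?wexpM; last lia.
  by rewrite wk muln2 even_halfK.
(* An odd power of the half twist exchanges the letters 0 and n - 1. *)
apply/negP=> ko; have := cw 0 (ltnW n1).
rewrite wk -[k]odd_double_half ko add1n wexpS -cat_cons garside_flip; last lia.
rewrite -!catA => /beq_catI; rewrite /= subn0 g2; last lia.
move/beq_catI/(beq_all (pred1 0)) => /=; lia.
Qed.

(** * Positive words as elements of the braid group *)

(** A right inverse of the letter [i] up to a full twist: one occurrence of the last
    letter in the full twist, led to the front by rotations, becomes [i] there,
    and is removed. *)
Definition letter_inv (n i : nat) : seq nat :=
  wexp (delta n) (n.-1 - i) ++ delta n.-1 ++ wexp (delta n) i.+1.

Lemma letter_inv_below n i : below n (letter_inv n i).
Proof.
have d := delta_below n.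
rewrite below_cat (wexp_below _ d) below_cat (wexp_below _ d) andbT.
exact: belowW (leq_pred n) (delta_below _).
Qed.

Lemma letter_invP n i : i < n -> i :: letter_inv n i ≡ twist n.
Proof.
move=> il; rewrite /letter_inv -cat_cons delta_exp_shift; last lia.
have -> : i + (n.-1 - i) = n.-1 by lia.
rewrite -catA; have -> : [:: n.-1] ++ delta n.-1 ++ wexp (delta n) i.+1 =
   wexp (delta n) i.+2.
  by case: n il.
by rewrite -wexpD; have -> : n.-1 - i + i.+2 = n.+1 by lia.
Qed.

Fixpoint word_inv (n : nat) (w : seq nat) : seq nat :=
  if w is i :: u then word_inv n u ++ letter_inv n i else [::].

Lemma word_inv_below n w : below n (word_inv n w).
Proof.
elim: w => //= i w IH; rewrite below_cat; apply/andP; split=> //.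
exact: letter_inv_below.
Qed.

Lemma word_invr n w : below n w -> w ++ word_inv n w ≡ wexp (twist n) (size w).
Proof.
elim: w => //= i w IH /andP[il /IH {}IH].
rewrite catA IH -twist_exp_pass; last exact: letter_inv_below.
by rewrite -cat_cons letter_invP.
Qed.

Lemma word_invl n w : below n w -> word_inv n w ++ w ≡ wexp (twist n) (size w).
Proof.
move=> wn; apply: (@beq_catI w).
by rewrite catA word_invr // twist_exp_pass.
Qed.

(** The pair [(w, k)] stands for the fraction [w / twist n ^ k]. *)
Definition frac : Type := (seq nat * nat)%type.

Definition frac_eq (n : nat) (p q : frac) : Prop :=
  p.1 ++ wexp (twist n) q.2 ≡ q.1 ++ wexp (twist n) p.2.

(** Terms have values in the fractions because each letter divides the full twist:
    [word_inv n w] is an inverse of [w] up to [size w] full twists. *)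
Fixpoint frac_of (n : nat) (t : gterm 'I_n) : frac :=
  match t with
  | gvar i => ([:: val i], 0)
  | gone => ([::], 0)
  | ginv t =>
      let: (w, k) := frac_of t in (word_inv n w ++ wexp (twist n) k, size w)
  | gmul t u =>
      let: (w, k) := frac_of t in
      let: (v, l) := frac_of u in (w ++ v, k + l)
  end.

Lemma frac_of_below n (t : gterm 'I_n) : below n (frac_of t).1.
Proof.
elim: t => [i|//|t|t + u] /=.
- by rewrite ltn_ord.
- case: (frac_of t) => w k /= _; rewrite below_cat; apply/andP; split.
    exact: word_inv_below.
  exact/wexp_below/twist_below.
- case: (frac_of t) (frac_of u) => [w k] [v l] /= wn vn.
  by rewrite below_cat; apply/andP.
Qed.

Lemma frac_eq_trans n p q r :
  frac_eq n p q -> frac_eq n q r -> frac_eq n p r.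
Proof.
case: p q r => [u k] [v l] [w m]; rewrite /frac_eq /= => e1 e2.
apply: (@beq_cat2I (wexp (twist n) l)).
rewrite -!catA -!wexpD ![_ + l]addnC !wexpD !catA e1.
by rewrite -catA -wexpD addnC wexpD catA e2 -!catA -!wexpD addnC.
Qed.

Lemma frac_eq_inv n u k v l : below n u -> below n v ->
    frac_eq n (u, k) (v, l) ->
  frac_eq n (word_inv n u ++ wexp (twist n) k, size u)
            (word_inv n v ++ wexp (twist n) l, size v).
Proof.
rewrite /frac_eq /= => un vn e; apply: (@beq_catI u).
rewrite [u ++ (word_inv n u ++ _) ++ _]catA [u ++ word_inv n u ++ _]catA.
rewrite word_invr // (twist_exp_pass _ (word_inv_below n v)).
rewrite !catA e -[(v ++ _) ++ _]catA -(twist_exp_pass _ (word_inv_below n v)).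
rewrite !catA word_invr // -!wexpD.
by have -> : size u + k + size v = size v + k + size u by lia.
Qed.

Lemma frac_eq_mul n u k u' k' v l v' l' : below n v -> below n v' ->
    frac_eq n (u, k) (u', k') -> frac_eq n (v, l) (v', l') ->
  frac_eq n (u ++ v, k + l) (u' ++ v', k' + l').
Proof.
rewrite /frac_eq /= => vn vn' e1 e2.
rewrite !wexpD -[(u ++ v) ++ _]catA [v ++ _ ++ _]catA (twist_exp_pass _ vn).
rewrite -[(u' ++ v') ++ _]catA [v' ++ _ ++ _]catA (twist_exp_pass _ vn').
by rewrite -!catA e2 catA e1 -!catA.
Qed.

(** The fractions satisfy the group axioms and the braid relations, so that terms
    with the same value in the braid group define equal fractions. *)
Lemma pres_eq_frac n (t u : gterm 'I_n.-1) : pres_eq (@braid_rel n) t u ->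
  frac_eq n.-1 (frac_of t) (frac_of u).
Proof.
elim=> {t u}.
- move=> t u [i j ij|i j ij]; rewrite /frac_eq /=.
    by rewrite adj_braid // /adj ij eqxx.
  by rewrite far_swap.
- by move=> t; rewrite /frac_eq.
- by move=> t u _; rewrite /frac_eq => /beq_sym.
- by move=> t u v _ + _; apply: frac_eq_trans.
- move=> t u _ /=; have := frac_of_below t; have := frac_of_below u.
  by case: (frac_of t) (frac_of u) => [w k] [v l] vn wn; apply: frac_eq_inv.
- move=> t t' u u' _ + _ /=; have := frac_of_below u; have := frac_of_below u'.
  case: (frac_of t) (frac_of t') => [w k] [w' k'].
  by case: (frac_of u) (frac_of u') => [v l] [v' l'] vn' vn; apply: frac_eq_mul.
- move=> t u v /=; case: (frac_of t) (frac_of u) (frac_of v) => [a k] [b l] [c m].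
  by rewrite /frac_eq catA addnA.
- by move=> t /=; case: (frac_of t) => w k; rewrite /frac_eq add0n.
- by move=> t /=; case: (frac_of t) => w k; rewrite /frac_eq cats0 addn0.
- move=> t /=; have := frac_of_below t.
  case: (frac_of t) => w k wn; rewrite /frac_eq /= cats0 wexpD -catA.
  by rewrite -twist_exp_pass // catA word_invl.
- move=> t /=; have := frac_of_below t.
  case: (frac_of t) => w k wn; rewrite /frac_eq /= cats0 [k + _]addnC wexpD.
  by rewrite catA word_invr.
Qed.

Local Open Scope group_scope.

Definition sigma (n i : nat) : Br n :=
  if insub i is Some j then pres_gen (@braid_rel n) j else 1.

Definition braid (n : nat) (w : seq nat) : Br n :=
  foldr (fun i b => sigma n i * b) 1 w.

Lemma sigmaE n (i : 'I_n.-1) : sigma n i = pres_gen (@braid_rel n) i.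
Proof. by rewrite /sigma valK. Qed.

Lemma braid_cat n u v : braid n (u ++ v) = braid n u * braid n v.
Proof. by elim: u => [|i u IH] /=; rewrite ?mul1g // IH mulgA. Qed.

Lemma braid_wexp n u k : braid n (wexp u k) = braid n u ^+ k.
Proof. by elim: k => //= k IH; rewrite braid_cat IH expgS. Qed.

Lemma sigma_rel n (t u : gterm 'I_n.-1) : braid_rel t u ->
  geval (sigma n \o val) t = geval (sigma n \o val) u.
Proof.
have -> : sigma n \o val = pres_gen (@braid_rel n).
  by apply/funext=> i /=; rewrite sigmaE.
by move=> tu; rewrite -!pres_classE; apply/pres_classP/pres_rel.
Qed.

Lemma sigma_far n i j : far i j -> i < n.-1 -> j < n.-1 ->
  sigma n i * sigma n j = sigma n j * sigma n i.
Proof.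
move=> ij il jl.
exact: (sigma_rel (@braid_comm n (Ordinal il) (Ordinal jl) ij)).
Qed.

Lemma sigma_adj n i j : adj i j -> i < n.-1 -> j < n.-1 ->
  sigma n i * sigma n j * sigma n i = sigma n j * sigma n i * sigma n j.
Proof.
move=> /orP[] /eqP ij il jl.
  exact: (sigma_rel (@braid_braid n (Ordinal il) (Ordinal jl) ij)).
exact/esym/(sigma_rel (@braid_braid n (Ordinal jl) (Ordinal il) ij)).
Qed.

Lemma beq_braid n u v : below n.-1 u -> u ≡ v -> braid n u = braid n v.
Proof.
move=> + uv; elim: uv => {u v} [//|u v w uv _ IH] un.
have vn : below n.-1 v by rewrite /below -(beq_all _ (beq_step1 uv)).
rewrite -{}IH // {w}; elim: uv un {vn} => {u v} /= [i j u ij|i j u ij|i u v _ IH].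
- by case/and3P=> il jl _; rewrite !mulgA (sigma_far ij).
- by case/and4P=> il jl _ _; rewrite !mulgA (sigma_adj ij).
- by case/andP=> _ /IH ->.
Qed.

(** Garside's embedding theorem: a positive word, seen as a term, is its own
    fraction with denominator 1. *)
Lemma braid_inj n u v : below n.-1 u -> below n.-1 v ->
  braid n u = braid n v -> u ≡ v.
Proof.
have termP w : below n.-1 w -> exists2 t : gterm 'I_n.-1,
    pres_class (@braid_rel n) t = braid n w & frac_of t = (w, 0).
  elim: w => [|i w IH] /=; first by exists gone.
  case/andP=> il /IH[t <- e].
  exists (gmul (gvar (Ordinal il)) t); last by rewrite /= e.
  by rewrite pres_classM; congr (_ * _); exact: esym (sigmaE (Ordinal il)).
move=> /termP[t <- et] /termP[r <- er] /pres_classP/pres_eq_frac.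
by rewrite et er /frac_eq /= !cats0.
Qed.

Definition full_twist (n : nat) : Br n := braid n (twist n.-1).

Lemma full_twist_central n c : commute (full_twist n) c.
Proof.
move: c; apply: central_gens => i; rewrite -sigmaE /commute.
have -> : sigma n i = braid n [:: val i] by rewrite /= mulg1.
rewrite /full_twist -!braid_cat; symmetry.
apply: beq_braid; last exact: (twist_comm (ltn_ord i)).
by rewrite /= ltn_ord; apply: twist_below.
Qed.

Lemma frac_ofP n (t : gterm 'I_n.-1) :
  pres_class (@braid_rel n) t * full_twist n ^+ (frac_of t).2 =
  braid n (frac_of t).1.
Proof.
elim: t => [i||t IH|t IHt u IHu] /=.
- by rewrite expg0 sigmaE.
- by rewrite expg0 mulg1.
- have := frac_of_below t; case: (frac_of t) IH => w k /= IH wn.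
  apply: (mulgI (pres_class (@braid_rel n) t)).
  rewrite pres_classV mulgA mulgV mul1g braid_cat braid_wexp mulgA.
  rewrite -[_ * _ * _]mulgA (commuteX k (commute_sym (full_twist_central _))).
  rewrite mulgA IH -braid_cat (beq_braid _ (word_invr wn)) 1?braid_wexp //.
  by rewrite below_cat wn word_inv_below.
- case: (frac_of t) (frac_of u) IHt IHu => [w k] [v l] /= et eu.
  rewrite pres_classM expgnDr braid_cat -et -eu !mulgA; congr (_ * _).
  rewrite -!mulgA; congr (_ * _).
  exact: (commuteX k (commute_sym (full_twist_central _))).
Qed.

(** Write [c] as a fraction [w / full_twist n ^ k].  Then [w] is central in the
    group, hence in the positive monoid by the embedding theorem, hence a power of
    the full twist, which is itself the [n]-th power of the rotation. *)
Theorem center_power n (c : Br n) : 2 < n -> (forall b, commute c b) ->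
  exists b, b ^+ n = c.
Proof.
move=> n2 cc; have [t tc] := pres_class_surj c.
have := frac_ofP t; have := frac_of_below t; case: (frac_of t) => w k /= wn.
rewrite tc => cw.
have [|i il|l wl] := @positive_center n.-1 w _ wn.
- lia.
- apply: (@braid_inj n); [by rewrite /= il|by rewrite below_cat /= il wn|].
  rewrite braid_cat [braid n [:: i]]/= mulg1 [LHS]/= -cw -mulgA.
  rewrite -(commuteX k (commute_sym (full_twist_central _))).
  by rewrite !mulgA cc.
pose d := braid n (delta n.-1).
have dn : d ^+ n = full_twist n.
  by rewrite /full_twist /twist braid_wexp prednK //; lia.
exists (d ^+ l / d ^+ k).
have dC : commute (d ^+ l) (d ^+ k) by apply: commuteX2.
rewrite expgnFl // !(expgnAC d _ n) dn.
apply: (mulIg (full_twist n ^+ k)); rewrite cw (beq_braid wn wl) braid_wexp.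
by rewrite divgK.
Qed.

(** * Winding of pairs of strands *)

Section Bijections.
Variable T : Type.

(** The inverse is part of the data so that the group inverse is given by a
    formula, without choice. *)
Definition bijection : Type :=
  {fg : (T -> T) * (T -> T) | cancel fg.1 fg.2 /\ cancel fg.2 fg.1}.

HB.instance Definition _ := gen_eqMixin bijection.
HB.instance Definition _ := gen_choiceMixin bijection.

Definition bij_fun (f : bijection) : T -> T := (sval f).1.
Definition bij_inv (f : bijection) : T -> T := (sval f).2.

Lemma bij_funK f : cancel (bij_fun f) (bij_inv f). Proof. by case: f => fg []. Qed.
Lemma bij_invK f : cancel (bij_inv f) (bij_fun f). Proof. by case: f => fg []. Qed.

Lemma bijection_eq f g : bij_fun f =1 bij_fun g -> f = g.
Proof.
case: f g => [[f f'] [fK f'K]] [[g g'] [gK g'K]]; rewrite /bij_fun /= => fg.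
apply: eq_exist; congr pair; apply/funext => x //.
by rewrite -[LHS]gK /= -fg; congr g'; apply: f'K.
Qed.

Definition bone : bijection := exist _ (id, id) (conj (frefl _) (frefl _)).
Definition binv (f : bijection) : bijection :=
  exist _ (bij_inv f, bij_fun f) (conj (bij_invK f) (bij_funK f)).
Definition bmul (f g : bijection) : bijection :=
  exist _ (bij_fun g \o bij_fun f, bij_inv f \o bij_inv g)
    (conj (can_comp (bij_funK g) (bij_funK f))
          (can_comp (bij_invK f) (bij_invK g))).

Lemma bmulA : associative bmul. Proof. by move=> f g h; apply: bijection_eq. Qed.
Lemma bmul1 : left_id bone bmul. Proof. by move=> f; apply: bijection_eq. Qed.
Lemma bmulr1 : right_id bone bmul. Proof. by move=> f; apply: bijection_eq. Qed.
Lemma bmulV : left_inverse bone binv bmul.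
Proof. by move=> f; apply: bijection_eq => x; apply: bij_invK. Qed.
Lemma bmulrV : right_inverse bone binv bmul.
Proof. by move=> f; apply: bijection_eq => x; apply: bij_funK. Qed.

HB.instance Definition _ := isGroup.Build bijection bmulA bmul1 bmulr1 bmulV bmulrV.

Lemma bij_funX (f : bijection) k : bij_fun (f ^+ k) =1 iter k (bij_fun f).
Proof. by elim: k => [|k IH] x; rewrite ?expg0 // expgS iterSr -IH. Qed.

End Bijections.

Local Open Scope nat_scope.

(** Two positions and the number of full turns made so far by the strands in these
    positions around each other. *)
Definition tracked : Type := (nat * nat * int)%type.

Definition swap (i a : nat) : nat :=
  if a == i then i.+1 else if a == i.+1 then i else a.

(** A full turn consists of two crossings.  Only the one which brings the first
    strand back to the left of the second is counted, so that the counter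
    increases by one for each full turn and stays an integer. *)
Definition cross (i : nat) (x : tracked) : tracked :=
  let: (a, b, w) := x in
  (swap i a, swap i b, w + Posz ((a == i.+1) && (b == i)))%R.

Definition uncross (i : nat) (x : tracked) : tracked :=
  let: (a, b, w) := x in
  (swap i a, swap i b, w - Posz ((a == i) && (b == i.+1)))%R.

Ltac case_ifs :=
  repeat match goal with
  | |- context [if ?c then _ else _] =>
    lazymatch c with
    | context [if _ then _ else _] => fail
    | _ => let h := fresh in case h : c => //=; try (exfalso; lia)
    end
  end.

Lemma crossK i : cancel (cross i) (uncross i).
Proof. by case=> -[a b] w; congr (_, _, _); rewrite /swap; case_ifs; lia. Qed.

Lemma uncrossK i : cancel (uncross i) (cross i).
Proof. by case=> -[a b] w; congr (_, _, _); rewrite /swap; case_ifs; lia. Qed.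

Lemma cross_far i j : far i j -> cross i \o cross j =1 cross j \o cross i.
Proof.
rewrite /far => ij [[a b] w].
by congr (_, _, _); rewrite /swap; case_ifs; lia.
Qed.

Lemma cross_braid i :
  cross i \o cross i.+1 \o cross i =1 cross i.+1 \o cross i \o cross i.+1.
Proof.
by case=> -[a b] w; congr (_, _, _); rewrite /swap; case_ifs; lia.
Qed.

Definition cross_bij (i : nat) : bijection tracked :=
  exist _ (cross i, uncross i) (conj (@crossK i) (@uncrossK i)).

Lemma tracking m : exists h : Br m -> bijection tracked,
  {morph h : x y / (x * y)%g} /\
  forall i, i < m.-1 -> bij_fun (h (sigma m i)) =1 cross i.
Proof.
have [|h [[hM hg] _]] := @presented_univ _ (@braid_rel m) _ (cross_bij \o val).
  move=> t u [i j ij|i j ij] /=; apply: bijection_eq => x.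
    by have := cross_braid i x; rewrite -ij.
  by have := cross_far ij x => /esym.
exists h; split=> // i il.
by rewrite (sigmaE (Ordinal il)) hg.
Qed.

(** The shape which [cross] shares with its products and inverses.  As the
    increments depend on the positions only, the counter is additive along
    iterations. *)
Definition moves_points (m : nat) (f : bijection tracked) : Prop :=
  exists p c, [/\ injective p, forall a, (p a < m) = (a < m) &
    forall a b w, bij_fun f (a, b, w) = (p a, p b, w + c a b)%R].

(** The inverse position map [q] is read off the diagonal pairs [(a, a, 0)]. *)
Lemma moves_pointsV m f : moves_points m f -> moves_points m f^-1%g.
Proof.
case=> p [c [pI pm fE]].
pose q a := (bij_inv f (a, a, 0%R)).1.1.
have pq a : p (q a) = a.
  have := bij_invK f (a, a, 0%R); rewrite /q.
  by case: (bij_inv f _) => -[x y] v; rewrite fE => -[].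
exists q, (fun a b => - c (q a) (q b))%R; split.
- by move=> a b qab; rewrite -(pq a) qab pq.
- by move=> a; rewrite -pm pq.
- move=> a b w; apply: (can_inj (bij_funK f)).
  rewrite -[LHS]/(bij_fun f (bij_inv f _)) bij_invK fE !pq.
  by congr (_, _, _); lia.
Qed.

Lemma tracking_moves_points m (h : Br m -> bijection tracked) :
    {morph h : x y / (x * y)%g} ->
    (forall i, i < m.-1 -> bij_fun (h (sigma m i)) =1 cross i) ->
  forall b, moves_points m (h b).
Proof.
move=> hM hs.
apply: pres_ind => [i||b hb|b d [p [c [pI pm pE]]] [q [e [qI qm qE]]]].
- exists (swap i), (fun a b : nat => Posz ((a == i.+1) && (b == i))); split.
  + by move=> a b; rewrite /swap; case_ifs; lia.
  + by move=> a; have := ltn_ord i; rewrite /swap; case_ifs; lia.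
  + by move=> a b w; rewrite -sigmaE hs.
- exists id, (fun _ _ => 0%R); split=> // a b w.
  by rewrite (morph_one hM) GRing.addr0.
- by rewrite (morph_inv hM); apply: moves_pointsV.
- exists (q \o p), (fun a b => c a b + e (p a) (p b))%R; split.
  + exact: inj_comp.
  + by move=> a /=; rewrite qm pm.
  + move=> a x w; rewrite hM -[LHS]/(bij_fun (h d) (bij_fun (h b) _)) pE qE.
    by rewrite GRing.addrA.
Qed.

(** The permutation of positions which underlies [delta k]. *)
Definition rot (k a : nat) : nat :=
  if a == k then 0 else if a < k then a.+1 else a.

Lemma delta_tracking m (h : Br m -> bijection tracked) k :
    {morph h : x y / (x * y)%g} ->
    (forall i, i < m.-1 -> bij_fun (h (sigma m i)) =1 cross i) ->
    k <= m.-1 ->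
  forall a b w, bij_fun (h (braid m (delta k))) (a, b, w) =
    (rot k a, rot k b, w + Posz ((a == k) && (b < k)))%R.
Proof.
move=> hM hs; elim: k => [|k IH] km a b w.
  rewrite /= (morph_one hM).
  by congr (_, _, _); rewrite /rot /=; case_ifs; lia.
rewrite deltaS [braid _ _]/= hM.
rewrite -[LHS]/(bij_fun (h (braid m (delta k))) (bij_fun (h (sigma m k)) _)).
rewrite hs // IH ?(ltnW km) //.
by congr (_, _, _); rewrite /rot /swap; case_ifs; lia.
Qed.

(** During the [m] rotations each strand goes exactly once from the last place to
    the first, passing the other strand; this is when the counter increases if the
    strand is the first of the pair. *)
Lemma full_twist_tracking m (h : Br m -> bijection tracked) :
    1 < m -> {morph h : x y / (x * y)%g} ->
    (forall i, i < m.-1 -> bij_fun (h (sigma m i)) =1 cross i) ->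
  forall a b w, a < m -> b < m -> a != b ->
  bij_fun (h (full_twist m)) (a, b, w) = (a, b, w + 1)%R.
Proof.
move=> m1 hM hs a b w am bm ab.
rewrite /full_twist /twist braid_wexp (morph_exp hM) bij_funX (ltn_predK m1).
pose f := bij_fun (h (braid m (delta m.-1))).
have iterf j : iter j f (a, b, w) =
    ((a + j) %% m, (b + j) %% m, w + Posz ((a + j) %/ m))%R.
  elim: j => [|j IH].
    by rewrite /= !addn0 !modn_small // divn_small // GRing.addr0.
  rewrite iterS IH /f delta_tracking //.
  (* When the first strand is in the last place, the second one is to its left. *)
  have nab : (a + j) %% m != (b + j) %% m by rewrite eqn_modDr !modn_small.
  have rotE x : rot m.-1 (x %% m) = x.+1 %% m.
    have := ltn_pmod x (ltnW m1); rewrite modnS /rot; set y := x %% m.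
    have -> : (m %| x.+1) = (y == m.-1).
      rewrite /dvdn -addn1 -modnDml -/y; have : y < m by apply: ltn_pmod; lia.
      rewrite leq_eqVlt => /orP[/eqP e|h2].
        by rewrite addn1 e modnn eqxx; apply/esym/eqP; lia.
      by rewrite modn_small ?addn1 //; lia.
    by move=> ym; case_ifs; lia.
  rewrite !rotE !addnS; congr (_, _, _).
  rewrite -GRing.addrA; congr (_ + _)%R.
  have ha := divn_eq (a + j) m; have hb := ltn_pmod (b + j) (ltnW m1).
  have la := ltn_pmod (a + j) (ltnW m1).
  move: nab hb ha la; set x := (a + j) %% m; set y := (b + j) %% m.
  set q := (a + j) %/ m => nab hb ha la.
  have -> : (a + j).+1 %/ m = q + (x == m.-1).
    rewrite ha -addnS divnMDl; last lia.
    congr addn; case: eqP => [->|ne]; first by rewrite prednK ?divnn //; lia.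
    by rewrite divn_small //; lia.
  have -> : (x == m.-1) && (y < m.-1) = (x == m.-1) by case: eqP => //= e; lia.
  by rewrite PoszD.
rewrite iterf !modnDr !modn_small // divnDr // divnn (divn_small am).
by congr (_, _, _); lia.
Qed.

Lemma injective_return (p : nat -> nat) m a : injective p ->
    (forall x, (p x < m) = (x < m)) -> a < m ->
  exists2 l, 0 < l <= m & iter l p a = a.
Proof.
move=> pI pm am.
have : looping p a m.
  apply: contraT; rewrite -looping_uniq => u.
  have : size (traject p a m.+1) <= size (iota 0 m).
    apply: uniq_leq_size u _ => x /trajectP[i _ ->]; rewrite mem_iota.
    by elim: i => //= i; rewrite !add0n pm.
  by rewrite size_traject size_iota ltnn.
case/trajectP=> i im e; exists (m - i); first lia.
have iI k : injective (iter k p) by elim: k => //= k; apply: inj_comp.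
by apply: (iI i); rewrite -iterD subnKC // ltnW.
Qed.

(** Two strands come back together after l <= m < n repetitions of [b].  Over n l
    repetitions their winding number is a multiple of n as well as equal to l. *)
Theorem full_twist_not_power m n (b : Br m) : 1 < m -> m < n ->
  (b ^+ n)%g <> full_twist m.
Proof.
move=> m1 mn bn; have [h [hM hs]] := tracking m.
have [p [c [pI pm pE]]] := tracking_moves_points hM hs b.
have [x [y [l [xm ym xy]]]] : exists x y l, [/\ x < m, y < m, x != y,
    0 < l <= m & iter l p x = x /\ iter l p y = y].
  (* The pair consists either of a fixed position and another one, or of two
     positions on the same orbit: in both cases one period serves both, so
     that l is at most m. *)
  case: (eqVneq (p 0) 0) => p0.
    have [l lm e] := injective_return pI pm m1.
    exists 0, 1, l; split=> //; first lia.
    by split=> //; elim: (l) => //= k ->.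
  have [|l lm e] := @injective_return p m 0 pI pm; first lia.
  exists 0, (p 0), l; split=> //; [lia|by rewrite pm; lia|by rewrite eq_sym|].
  by split=> //; rewrite -iterSr iterS e.
move=> lm [ex ey].
set f := bij_fun (h b) in pE.
have iterE k : exists d, forall w,
    iter k f (x, y, w) = (iter k p x, iter k p y, w + d)%R.
  elim: k => [|k [d IH]]; first by exists 0%R => w; rewrite GRing.addr0.
  by eexists=> w; rewrite iterS IH pE -GRing.addrA.
have [d dE] := iterE l; rewrite ex ey in dE.
have e1 k w : iter (k * l) f (x, y, w) = (x, y, w + d *+ k)%R.
  elim: k w => [|k IH] w; first by rewrite GRing.addr0.
  by rewrite mulSn addnC iterD dE IH GRing.mulrS GRing.addrA.
have e2 k w : iter (n * k) f (x, y, w) = (x, y, w + Posz k)%R.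
  elim: k w => [|k IH] w; first by rewrite muln0 GRing.addr0.
  rewrite mulnS addnC iterD -[iter n f _]bij_funX -(morph_exp hM) bn.
  rewrite full_twist_tracking // IH.
  by congr (_, _, _); lia.
have := e2 l 0%R; rewrite e1 => -[].
rewrite !GRing.add0r -GRing.mulr_natr natz => /(congr1 absz); rewrite abszM /= => e.
have : n %| l by rewrite -e dvdn_mull.
by case/andP: lm => l0 lm /(dvdn_leq l0); lia.
Qed.

(** * Sentences *)

Local Open Scope group_scope.

Section Isomorphism.
Variables (G H : groupType) (f : G -> H).
Hypotheses (fM : {morph f : x y / x * y}) (f_bij : bijective f).

Lemma geval_iso (X : Type) (env : X -> G) t : f (geval env t) = geval (f \o env) t.
Proof.
elim: t => //= [|t <-|t <- u <-]; last exact: fM.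
- exact: morph_one.
- exact: morph_inv.
Qed.

Lemma push_iso n (x : G) (env : 'I_n -> G) :
  f \o push x env = push (f x) (f \o env).
Proof. by apply/funext => i /=; rewrite /push; case: unlift. Qed.

Lemma sat_iso n (env : 'I_n -> G) phi : sat env phi <-> sat (f \o env) phi.
Proof.
have [g fK gK] := f_bij.
elim: phi env => {n} n /=.
- move=> t u env; rewrite -!geval_iso; split=> [-> //|]; exact: (bij_inj f_bij).
- by move=> p IH env; rewrite IH.
- by move=> p IHp q IHq env; rewrite IHp IHq.
- by move=> p IHp q IHq env; rewrite IHp IHq.
- by move=> p IHp q IHq env; rewrite IHp IHq.
- move=> p IH env; split=> h x; last by rewrite IH push_iso.
  by rewrite -(gK x) -push_iso -IH.
- move=> p IH env; split=> -[x h].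
    by exists (f x); rewrite -push_iso -IH.
  by exists (g x); rewrite IH push_iso gK.
Qed.

End Isomorphism.

Lemma isomorphic_theory (G H : groupType) : isomorphic G H ->
  elementary_theory G = elementary_theory H.
Proof.
case=> f fM fb; apply/seteqP.
have e phi : holds G phi <-> holds H phi.
  rewrite /holds (sat_iso fM fb).
  by have -> : f \o @no_var G = @no_var H by apply/funext => -[].
by split=> phi /e.
Qed.

Lemma isomorphic_refl (G : groupType) : isomorphic G G.
Proof. by exists id => //; exists id. Qed.

Definition tpow (X : Type) (t : gterm X) (k : nat) : gterm X :=
  iter k (gmul t) gone.

Lemma geval_tpow (X : Type) (G : groupType) (env : X -> G) t k :
  geval env (tpow t k) = geval env t ^+ k.
Proof. by elim: k => //= k ->; rewrite expgS. Qed.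

Lemma push0 (T : Type) n (x : T) (env : 'I_n -> T) : push x env ord0 = x.
Proof. by rewrite /push unlift_none. Qed.

Lemma pushS (T : Type) n (x : T) (env : 'I_n -> T) i :
  push x env (lift ord0 i) = env i.
Proof. by rewrite /push liftK. Qed.

(** When [x] is not central, [y] can be chosen so as not to commute with it.  Hence
    the centrality of [x] need not be stated, which would take another
    quantifier. *)
Definition central_power_sentence (n : nat) : sentence :=
  let x : gterm 'I_3 := gvar (lift ord0 (lift ord0 ord0)) in
  let y : gterm 'I_3 := gvar (lift ord0 ord0) in
  fAll (fEx (fAll (fImp (fEq (gmul x y) (gmul y x)) (fEq (tpow y n) x)))).

Lemma central_power_AEA1 n : AEA1 (central_power_sentence n).
Proof. by apply: ex_intro2 (erefl _). Qed.

Lemma holds_central_power (G : groupType) n :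
  holds G (central_power_sentence n) <->
  forall x : G, (forall y, commute x y) -> exists y, y ^+ n = x.
Proof.
rewrite /holds /=; split=> h x.
  move=> cx; have [y hy] := h x; exists y; move: (hy 1).
  by rewrite geval_tpow /= !pushS !push0; apply; apply: cx.
have [cx|] := pselect (forall y, commute x y).
  by have [y yx] := h x cx; exists y => z; rewrite geval_tpow /= !pushS !push0.
move=> /existsNP[y xy]; exists y => z.
by rewrite /= !pushS !push0 => /xy.
Qed.

Lemma central_power_separates (m n : nat) : (1 < m)%N -> (m < n)%N ->
  AEA1_theory (Br m) <> AEA1_theory (Br n).
Proof.
move=> m1 mn e.
have [] : AEA1_theory (Br m) (central_power_sentence n).
  rewrite e; split; last exact: central_power_AEA1.
  apply/holds_central_power => c cc; apply: center_power => //.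
  exact: leq_ltn_trans m1 mn.
move=> /holds_central_power/(_ (full_twist m) (@full_twist_central m))[b bn] _.
exact: full_twist_not_power bn.
Qed.

Theorem corollary4p2 (m n : nat) (hm : 2 <= m) (hn : 2 <= n) :
  (elementary_theory (Br m) = elementary_theory (Br n)
     <-> isomorphic (Br m) (Br n))
  /\ (AEA1_theory (Br m) = AEA1_theory (Br n)
     <-> isomorphic (Br m) (Br n)).
Proof.
have AEA1_iso : AEA1_theory (Br m) = AEA1_theory (Br n) -> isomorphic (Br m) (Br n).
  case: (ltngtP m n) => [mn|nm|->] e; last exact: isomorphic_refl.
    by case: (central_power_separates hm mn).
  by case: (central_power_separates hn nm).
split; split=> [e|/isomorphic_theory e //].
- by apply: AEA1_iso; rewrite /AEA1_theory e.
- exact: AEA1_iso.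
- by rewrite /AEA1_theory e.
Qed.
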